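(* Fix a constant $\eta\in(0,1)$. Consider group testing with the i.i.d. Bernoulli test design with parameter $\nu$ chosen such that $(1-\frac{\nu}{k})^k=\frac12$, and suppose that $n\le(1-\eta)\log_2\binom{p}{k}$. Then, when $k=k(p)$ satisfies $k=o\big(p^{\frac{\eta}{1+\eta}}\big)$ as $p\to\infty$, we have $$ \chi^2(P\|Q) = \frac{1}{\binom{p}{k}}\sum_{l=0}^{k}\binom{k}{l}\binom{p-k}{l}2^{n(1-\frac{l}{k})}-1 \;\to\; 0 $$ as $p\to\infty$. Hence, the smallest possible error probability for the binary hypothesis test between $P(\mathbf{X},\mathbf{Y})$ and $Q(\mathbf{X},\mathbf{Y})=P(\mathbf{X})P(\mathbf{Y})$ behaves as $\mathsf{P}_{\mathrm{e}}=\frac12+o(1)$.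
   Context: Probabilistic (noiseless) group testing: there are $p$ items $\{1,\dots,p\}$, and the defective set $S$ is uniformly distributed over the $\binom{p}{k}$ subsets of $\{1,\dots,p\}$ of cardinality $k\ge 1$. I.i.d. Bernoulli design: the test matrix $\mathbf{X}\in\{0,1\}^{n\times p}$ has i.i.d. Bernoulli$(\nu/k)$ entries, independent of $S$, where $X^{(i)}_j=1$ iff item $j$ is in test $i$. The outcomes are $\mathbf{Y}\in\{0,1\}^n$ with $Y^{(i)}=\bigvee_{j\in S}X^{(i)}_j$. $P(\mathbf{X},\mathbf{Y})$ denotes the resulting joint distribution of $(\mathbf{X},\mathbf{Y})$ (with $S$ averaged out), and $Q(\mathbf{X},\mathbf{Y})=P(\mathbf{X})P(\mathbf{Y})$ is the product of its marginals (here $P(\mathbf{Y})=2^{-n}$ for every $\mathbf{Y}$). The divergence is $\chi^2(P\|Q)=\mathbb{E}_Q\big[\big(\tfrac{P(\mathbf{X},\mathbf{Y})}{Q(\mathbf{X},\mathbf{Y})}-1\big)^2\big]$. $\mathsf{P}_{\mathrm{e}}$ is the Bayesian error probability of a test that observes $(\mathbf{X},\mathbf{Y})$ drawn from $P$ or $Q$ with prior probability $\frac12$ each and guesses which. *)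

(* Defs.v *)
From HB Require Import structures.
From mathcomp Require Import all_boot all_order all_algebra.
From mathcomp Require Import all_classical all_reals all_analysis.

Set Implicit Arguments.
Unset Strict Implicit.
Unset Printing Implicit Defensive.

Import Order.TTheory GRing.Theory Num.Theory.
Import numFieldNormedType.Exports.

Local Open Scope classical_set_scope.
Local Open Scope ring_scope.

Definition log2 (R : realType) (x : R) : R := ln x / ln 2.

Definition expectation_pmf (R : realType) (T : finType) (Q f : T -> R) : R :=
  \sum_(z : T) Q z * f z.

(* E_Q[(P/Q - 1)^2].  Points where Q vanishes contribute 0, so this is the
   chi-square divergence when P is absolutely continuous with respect to Q; a
   joint law is always absolutely continuous with respect to the product of its
   marginals. *)
Definition chi2 (R : realType) (T : finType) (P Q : T -> R) : R :=
  expectation_pmf Q (fun z => (P z / Q z - 1) ^+ 2).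

(* [phi z] is the probability that a (possibly randomized) test decides for P
   after observing z; deterministic tests are those with values in {0, 1}. *)
Definition is_test (R : realType) (T : finType) (phi : T -> R) : Prop :=
  forall z, 0 <= phi z <= 1.

Definition test_error (R : realType) (T : finType) (P Q phi : T -> R) : R :=
  2^-1 * (\sum_(z : T) P z * (1 - phi z)) + 2^-1 * (\sum_(z : T) Q z * phi z).

Definition min_error (R : realType) (T : finType) (P Q : T -> R) : R :=
  inf [set e : R | exists phi : T -> R, is_test phi /\ e = test_error P Q phi].

Definition fst_marginal (R : realType) (A B : finType) (P : A * B -> R)
  (a : A) : R := \sum_(b : B) P (a, b).

Definition snd_marginal (R : realType) (A B : finType) (P : A * B -> R)
  (b : B) : R := \sum_(a : A) P (a, b).

Definition prod_marginals (R : realType) (A B : finType) (P : A * B -> R)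
  (z : A * B) : R := fst_marginal P z.1 * snd_marginal P z.2.

Definition defective_pmf (R : realType) (p k : nat) (S : {set 'I_p}) : R :=
  if #|S| == k then ('C(p, k)%:R)^-1 else 0.

Definition design_pmf (R : realType) (n p : nat) (theta : R)
  (X : 'M[bool]_(n, p)) : R :=
  \prod_(i < n) \prod_(j < p) bernoulli_pmf theta (X i j).

Definition outcome (n p : nat) (X : 'M[bool]_(n, p)) (S : {set 'I_p})
  : 'cV[bool]_n := \col_(i < n) [exists j in S, X i j].

Definition joint_pmf (R : realType) (n p k : nat) (nu : R)
  (z : 'M[bool]_(n, p) * 'cV[bool]_n) : R :=
  \sum_(S : {set 'I_p})
    defective_pmf R k S * design_pmf (nu / k%:R) z.1
      * (z.2 == outcome z.1 S)%:R.

(* Main.v *)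
Require Import Defs.
From HB Require Import structures.
From mathcomp Require Import all_boot all_order all_algebra.
From mathcomp Require Import all_classical all_reals all_analysis.
From mathcomp Require Import ring lra.

Import Order.TTheory GRing.Theory Num.Theory.
Import numFieldNormedType.Exports.

Local Open Scope ring_scope.

(* The rows of the design being independent, for two defective sets of size k
   with #|S' :\: S| = l a row gives the same outcome under both with
   probability q ^+ l, where q = 1 - nu / k and q ^+ k = 1/2; averaging over S
   and S' gives the formula for the divergence.  Writing m = k - l for the
   overlap, the weights satisfy
     'C(k, m) * 'C(p - k, k - m) / 'C(p, k) <= 'C(k, m) * (k / p) ^+ m,
   and 'C(p, k) * (k / p) ^+ k <= (1 + k / p) ^+ p <= e ^+ k bounds 2 ^ (n / k)
   by (e p / k) ^ (1 - eta).  By the binomial theorem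
     chi2 + 1 <= (1 + e (k / p) ^ eta) ^+ k <= exp (e k (k / p) ^ eta),
   whose exponent tends to 0 under the sparsity hypothesis.  The best test beats
   random guessing by at most half the L1 distance between P and Q, hence by at
   most sqrt(chi2) / 2. *)

(** * Independence of the rows of a Bernoulli design *)

(** Identifying a matrix with the family of its rows turns this into distributivity of products over
    sums. *)
Lemma sum_matrix_prod_rows {R : comNzRingType} {T : finType} {n p : nat}
    (F : 'I_n -> {ffun 'I_p -> T} -> R) :
  \sum_(X : 'M[T]_(n, p)) \prod_(i < n) F i [ffun j => X i j]
  = \prod_(i < n) \sum_r F i r.
Proof.
rewrite bigA_distr_bigA /=.
rewrite (reindex (fun f : {ffun 'I_n -> {ffun 'I_p -> T}} =>
  \matrix_(i < n, j < p) f i j)) /=.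
  apply: eq_bigr => f _; apply: eq_bigr => i _; congr (F i _).
  by apply/ffunP => j; rewrite ffunE mxE.
exists (fun X => [ffun i => [ffun j => X i j]]) => [f _|X _].
  by apply/ffunP => i; apply/ffunP => j; rewrite !ffunE mxE.
by apply/matrixP => i j; rewrite mxE !ffunE.
Qed.

Section BernoulliDesign.
Context {R : realType} {theta : R}.

Definition row_pmf {p : nat} (r : {ffun 'I_p -> bool}) : R :=
  \prod_(j < p) bernoulli_pmf theta (r j).

Lemma sum_design_rows {n p : nat} (g : 'I_n -> {ffun 'I_p -> bool} -> R) :
  \sum_X design_pmf theta X * \prod_(i < n) g i [ffun j => X i j]
  = \prod_(i < n) \sum_r row_pmf r * g i r.
Proof.
rewrite -sum_matrix_prod_rows; apply: eq_bigr => X _.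
rewrite /design_pmf -big_split /=; apply: eq_bigr => i _; congr (_ * _).
by apply: eq_bigr => j _; rewrite ffunE.
Qed.

(** The event factors over the columns: a column in [A] contributes [1 - theta], any other one its
    total mass 1. *)
Lemma row_none {p : nat} (A : {set 'I_p}) :
  \sum_r row_pmf r * (~~ [exists j in A, r j])%:R = (1 - theta) ^+ #|A|.
Proof.
transitivity (\sum_(r : {ffun 'I_p -> bool})
    \prod_j (bernoulli_pmf theta (r j) * ((j \in A) ==> ~~ r j)%:R)).
  apply: eq_bigr => r _; rewrite big_split /=; congr (_ * _).
  rewrite negb_exists_in; case: forall_inP => [h|h].
    by rewrite big1 // => j _; case: (boolP (j \in A)) => //= /h ->.
  have /existsP[j] : [exists j, (j \in A) && r j].
    apply: contra_notT h => /existsPn h j jA; have := h j.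
    by rewrite jA.
  by case/andP=> jA rj; rewrite (bigD1 j) //= jA rj mul0r.
rewrite -(bigA_distr_bigA (fun j b => bernoulli_pmf theta b * ((j \in A) ==> ~~ b)%:R)).
rewrite -prodr_const [RHS]big_mkcond /=; apply: eq_bigr => j _.
rewrite big_bool /=; case: (j \in A) => /=; rewrite /bernoulli_pmf /=; lra.
Qed.

Lemma row_pmf_sum1 {p : nat} : \sum_(r : {ffun 'I_p -> bool}) row_pmf r = 1.
Proof.
rewrite -[RHS](expr0 (1 - theta)) -(cards0 'I_p) -row_none.
apply: eq_bigr => r _; rewrite (_ : [exists j in _, _] = false) ?mulr1 //.
by apply/negbTE/existsPn => j; rewrite inE.
Qed.

(** With a, b the two outcomes, the indicator of a = b is 1 - [not a] - [not b] + 2 [not (a or b)],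
    and [row_none] evaluates each negated event. *)
Lemma row_agree {p : nat} (A B : {set 'I_p}) :
  \sum_r row_pmf r * ([exists j in A, r j] == [exists j in B, r j])%:R
  = 1 - (1 - theta) ^+ #|A| - (1 - theta) ^+ #|B|
    + 2 * (1 - theta) ^+ #|A :|: B|.
Proof.
rewrite -!row_none -[X in X - _ - _](@row_pmf_sum1 p) mulr_sumr -!sumrB -big_split /=.
apply: eq_bigr => r _.
have -> : [exists j in A :|: B, r j]
    = [exists j in A, r j] || [exists j in B, r j].
  apply/existsP/orP => [[j]|].
    by rewrite inE andb_orl => /orP[]h; [left|right]; apply/existsP; exists j.
  by case=> /existsP[j /andP[h1 h2]]; exists j; rewrite inE h1 h2 ?orbT.
by case: [exists j in A, r j]; case: [exists j in B, r j] => /=; ring.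
Qed.

(** The product form is what lets a sum over designs split into rows. *)
Lemma eq_colE {T : eqType} {n : nat} (u v : 'cV[T]_n) :
  (u == v)%:R = \prod_(i < n) (u i 0 == v i 0)%:R :> R.
Proof.
case: eqP => [->|h]; first by rewrite big1 // => i _; rewrite eqxx.
have /existsP[i hi] : [exists i, u i 0 != v i 0].
  apply: contra_notT h => /existsPn h; apply/matrixP => i j.
  by rewrite ord1; apply/eqP; rewrite -[_ == _]negbK h.
by rewrite (bigD1 i) //= (negbTE hi) mul0r.
Qed.

Lemma outcomeE {n p : nat} (X : 'M[bool]_(n, p)) (S : {set 'I_p}) i :
  outcome X S i 0 = [exists j in S, [ffun j => X i j] j].
Proof.
by rewrite mxE; apply: eq_existsb => j; rewrite ffunE.
Qed.

Lemma design_sum1 {n p : nat} :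
  \sum_(X : 'M[bool]_(n, p)) design_pmf theta X = 1.
Proof.
have := @sum_design_rows n p (fun _ _ => 1).
under eq_bigr do rewrite big1 // mulr1.
move->; rewrite big1 // => i _.
by under eq_bigr do rewrite mulr1; rewrite row_pmf_sum1.
Qed.

Lemma design_outcomes_agree {n p : nat} (A B : {set 'I_p}) :
  \sum_(X : 'M[bool]_(n, p))
     design_pmf theta X * (outcome X A == outcome X B)%:R
  = (1 - (1 - theta) ^+ #|A| - (1 - theta) ^+ #|B|
    + 2 * (1 - theta) ^+ #|A :|: B|) ^+ n.
Proof.
rewrite -row_agree.
rewrite -[X in _ ^+ X](card_ord n) -prodr_const.
rewrite -[RHS](sum_design_rows (fun _ r =>
  ([exists j in A, r j] == [exists j in B, r j])%:R)); apply: eq_bigr => X _; rewrite eq_colE.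
by congr (_ * _); apply: eq_bigr => i _; rewrite !outcomeE.
Qed.

(** Each test is positive with probability 1/2, so the outcome vector is uniform. *)
Lemma design_outcome_half {n p : nat} {S : {set 'I_p}} {y : 'cV[bool]_n} :
  (1 - theta) ^+ #|S| = 2^-1 ->
  \sum_X design_pmf theta X * (y == outcome X S)%:R = 2^-1 ^+ n.
Proof.
move=> half.
transitivity (\prod_(i < n) \sum_r row_pmf r *
    (y i 0 == [exists j in S, (r : {ffun 'I_p -> bool}) j])%:R).
  rewrite -sum_design_rows; apply: eq_bigr => X _; rewrite eq_colE.
  by congr (_ * _); apply: eq_bigr => i _; rewrite outcomeE.
rewrite -[in RHS](card_ord n) -prodr_const; apply: eq_bigr => i _.
case: (y i 0).
  transitivity (1 - (1 - theta) ^+ #|S|); last by rewrite half; lra.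
  rewrite -row_none -[X in X - _](@row_pmf_sum1 p) -sumrB.
  by apply: eq_bigr => r _; case: [exists j in S, r j] => /=; ring.
rewrite -half -row_none; apply: eq_bigr => r _; congr (_ * _%:R).
Qed.

Lemma design_pmf_ge0 {n p : nat} (X : 'M[bool]_(n, p)) :
  0 <= theta <= 1 -> 0 <= design_pmf theta X.
Proof.
by move=> theta01; do 2 apply: prodr_ge0 => ? _; exact: bernoulli_pmf_ge0.
Qed.

End BernoulliDesign.

(** * Counting sets of size k by the number of elements outside a fixed one *)

(* B is determined by the pair (B :&: S, B :\: S) of independent choices. *)
Lemma card_draws_setD {p k l : nat} {S : {set 'I_p}} :
  #|S| = k -> (l <= k)%N ->
  #|[set B : {set 'I_p} | (#|B| == k) && (#|B :\: S| == l)]|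
  = ('C(k, l) * 'C(p - k, l))%N.
Proof.
move=> Sk lk.
have cSC : #|~: S| = (p - k)%N by rewrite cardsCs finset.setCK Sk card_ord.
pose U := [set A : {set 'I_p} | (A \subset S) && (#|A| == k - l)%N].
pose V := [set A : {set 'I_p} | (A \subset ~: S) && (#|A| == l)].
have -> : ('C(k, l) * 'C(p - k, l))%N = #|finset.setX U V|.
  by rewrite cardsX !cards_draws Sk cSC bin_sub.
rewrite -(@card_in_imset _ _ (fun x : {set 'I_p} * {set 'I_p} => x.1 :|: x.2)); last first.
  move=> [A1 B1] [A2 B2] /setXP[] /=.
  rewrite !inE => /andP[a1 _] /andP[b1 _] /andP[/andP[a2 _] /andP[b2 _]] E.
  (* The union determines both pieces, which gives injectivity. *)
  have h (A B : {set 'I_p}) : A \subset S -> B \subset ~: S ->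
      A = (A :|: B) :&: S /\ B = (A :|: B) :\: S.
    move=> AS BS; rewrite finset.setIUl finset.setDUl.
    rewrite (finset.setIidPl AS) [B :\: S]finset.setDE (finset.setIidPl BS).
    have -> : A :\: S = finset.set0 by apply/eqP; rewrite finset.setD_eq0.
    have -> : B :&: S = finset.set0 by apply/eqP; rewrite finset.setI_eq0 finset.disjoints_subset.
    by rewrite finset.setU0 finset.set0U.
  move: E => /= E.
  have [ea1 eb1] := h A1 B1 a1 b1; have [ea2 eb2] := h A2 B2 a2 b2.
  by congr (_, _); [rewrite ea1 ea2 E | rewrite eb1 eb2 E].
apply: eq_card => B; rewrite inE; apply/andP/imsetP => [[/eqP Bk /eqP Bl]|].
  exists (B :&: S, B :\: S); last by rewrite /= finset.setID.
  rewrite !inE /= finset.subsetIr /= Bl eqxx andbT.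
  rewrite finset.setDE finset.subsetIr andbT.
  by rewrite -(eqn_add2r l) subnK // -{1}Bl cardsID Bk.
case=> [[A1 B1]] /setXP[] /=.
rewrite !inE => /andP[a1 /eqP a1c] /andP[b1 /eqP b1c] ->.
have e1 : A1 :\: S = finset.set0 by apply/eqP; rewrite finset.setD_eq0.
have e2 : B1 :\: S = B1 by rewrite finset.setDE (finset.setIidPl b1).
split.
  rewrite cardsU a1c b1c (_ : A1 :&: B1 = finset.set0) ?cards0 ?subn0 ?subnK //.
  apply/eqP; rewrite finset.setI_eq0 finset.disjoints_subset (fintype.subset_trans a1) //.
  by rewrite -finset.setCS finset.setCK.
by rewrite finset.setDUl e1 e2 finset.set0U b1c.
Qed.

Lemma sum_draws_setD {R : comNzRingType} {p k : nat} {S : {set 'I_p}} (g : nat -> R) :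
  #|S| = k ->
  \sum_(B : {set 'I_p} | #|B| == k) g #|B :\: S|
  = \sum_(0 <= l < k.+1) 'C(k, l)%:R * 'C(p - k, l)%:R * g l.
Proof.
move=> Sk; rewrite big_mkord.
(* [inord] loses nothing: a set of size k has at most k elements outside [S]. *)
rewrite (partition_big (fun B : {set 'I_p} => inord #|B :\: S| : 'I_k.+1) xpredT) //=.
apply: eq_bigr => l _.
have lk : (l <= k)%N by rewrite -ltnS.
rewrite -natrM -(card_draws_setD Sk lk) mulr_natl.
have E (B : {set 'I_p}) : #|B| == k ->
    ((inord #|B :\: S| : 'I_k.+1) == l) = (#|B :\: S| == l).
  move=> /eqP Bk; rewrite -val_eqE /= inordK // ltnS -Bk.
  by rewrite subset_leq_card // finset.subsetDl.
rewrite -sumr_const; apply: eq_big => [B|B /andP[/E-> /eqP ->]] //.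
by rewrite inE; apply: andb_id2l => /E.
Qed.

(** * Bounds on the overlap weights *)

(** The ratio of the two binomials is the product of (k - i) / (p - i) over i < m, each factor being
    at most k / p; denominators are cleared to stay in [nat]. *)
Lemma bin_sub_le {p k m : nat} : (m <= k)%N -> (k <= p)%N ->
  ('C(p - m, k - m) * p ^ m <= k ^ m * 'C(p, k))%N.
Proof.
elim: m => [|m IH] mk kp; first by rewrite !subn0 muln1 mul1n.
have := IH (ltnW mk) kp => {}IH.
have pm0 : (0 < p - m)%N by rewrite subn_gt0 (leq_trans mk).
have km0 : (0 < k - m)%N by rewrite subn_gt0.
have pk : (p * (k - m) <= k * (p - m))%N.
  by rewrite !mulnBr [(k * p)%N]mulnC leq_sub2l // leq_mul2r kp orbT.
rewrite !subnS; move: pm0 km0 pk IH.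
case: (p - m)%N => // a; case: (k - m)%N => // b _ _ pk IH /=.
(* Scaling by [a.+1] lets [mul_bin_diag] reach the binomial of the induction hypothesis. *)
rewrite -(leq_pmul2l (ltn0Sn a)) mulnA mul_bin_diag.
rewrite [leqLHS](_ : _ = p * b.+1 * ('C(a.+1, b.+1) * p ^ m))%N; last by rewrite expnS; ring.
rewrite [leqRHS](_ : _ = k * a.+1 * (k ^ m * 'C(p, k)))%N; last by rewrite expnS; ring.
exact: leq_mul.
Qed.

Section Overlap.
Context {R : realType}.

(** An elementary substitute for Stirling's formula: it bounds the binomial by (e p / k) ^ k. *)
Lemma bin_exp_bound {p k : nat} : (0 < k)%N -> (k <= p)%N ->
  'C(p, k)%:R * (k%:R / p%:R) ^+ k <= expR k%:R :> R.
Proof.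
move=> k0 kp; have p0 : (0 < p)%N := leq_trans k0 kp.
set x : R := k%:R / p%:R; have x0 : 0 <= x by rewrite divr_ge0.
apply: (@le_trans _ _ ((1 + x) ^+ p)).
  rewrite exprDn (bigD1 (inord k : 'I_p.+1)) //= inordK ?ltnS //.
  rewrite expr1n mul1r mulr_natl lerDl.
  by apply: sumr_ge0 => i _; rewrite mulrn_wge0 // expr1n mul1r exprn_ge0.
have -> : expR k%:R = expR x ^+ p :> R.
  by rewrite -expRM_natl mulrC divfK // pnatr_eq0 -lt0n.
by rewrite lerXn2r ?nnegrE ?addr_ge0 ?expR_ge0 // expR_ge1Dx.
Qed.

(** [w] stands for 2 ^ (n / k). The comparison is term by term with the binomial expansion of the
    right-hand side. *)
Lemma overlap_sum_le {p k : nat} {w : R} : (0 < k)%N -> (k <= p)%N -> 0 <= w ->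
  ('C(p, k)%:R)^-1 * (\sum_(0 <= l < k.+1)
     'C(k, l)%:R * 'C(p - k, l)%:R * w ^+ (k - l))
  <= (1 + k%:R / p%:R * w) ^+ k.
Proof.
move=> k0 kp w0; have p0 : (0 < p)%N := leq_trans k0 kp.
have N0 : 0 < 'C(p, k)%:R :> R by rewrite ltr0n bin_gt0.
(* Reversing the index makes it the overlap k - l, which is the exponent of [w]. *)
rewrite exprDn big_mkord ler_pdivrMl // mulr_sumr (reindex_inj rev_ord_inj) /=.
apply: ler_sum => i _; rewrite subSS.
have ik : (i <= k)%N by rewrite -ltnS.
rewrite expr1n mul1r subKn // exprMn -[X in _ <= _ * X]mulr_natl bin_sub //.
rewrite [leRHS](_ : _ = 'C(k, i)%:R * ('C(p, k)%:R * (k%:R / p%:R) ^+ i) * w ^+ i); last by ring.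
rewrite ler_wpM2r ?exprn_ge0 // ler_wpM2l ?ler0n //.
(* Enlarging p - k to p - i gives the binomial that [bin_sub_le] controls. *)
apply: (@le_trans _ _ 'C(p - i, k - i)%:R).
  by rewrite ler_nat leq_bin2l // leq_sub2l.
rewrite expr_div_n mulrA ler_pdivlMr ?exprn_gt0 ?ltr0n //.
by rewrite -!natrX -!natrM ler_nat mulnC [leqRHS]mulnC mulnC bin_sub_le.
Qed.

End Overlap.

Local Open Scope classical_set_scope.

(** * Chi-square divergence and testing error *)

Section Chi2.
Context {R : realType} {T : finType} {P Q : T -> R}.
Hypotheses (Q_ge0 : forall z, 0 <= Q z) (Q_sum1 : \sum_z Q z = 1).
Hypothesis P_sum1 : \sum_z P z = 1.
Hypothesis P_acQ : forall z, Q z = 0 -> P z = 0.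

Lemma chi2_ge0 : 0 <= chi2 P Q.
Proof. by apply: sumr_ge0 => z _; rewrite mulr_ge0 ?sqr_ge0. Qed.

Lemma chi2_sum_sqr : chi2 P Q = \sum_z P z ^+ 2 / Q z - 1.
Proof.
transitivity (\sum_z (P z ^+ 2 / Q z - 2 * P z + Q z)); last first.
  rewrite big_split sumrB /= -mulr_sumr P_sum1 Q_sum1; ring.
(* At a zero of [Q] quotients are 0 by convention, and absolute continuity removes the remaining
   [P z]. *)
apply: eq_bigr => z _; have [Q0|Q0] := eqVneq (Q z) 0.
  by rewrite Q0 P_acQ // expr2; ring.
by field.
Qed.

(** The L1 distance is the mean of |P/Q - 1| under [Q], and a mean is at most the root mean
    square. *)
Lemma sum_dist_le_sqrt_chi2 : \sum_z `|P z - Q z| <= Num.sqrt (chi2 P Q).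
Proof.
pose f z := `|P z / Q z - 1|; pose m := \sum_z Q z * f z.
have -> : \sum_z `|P z - Q z| = m.
  apply: eq_bigr => z _; have [Q0|Q0] := eqVneq (Q z) 0.
    by rewrite Q0 P_acQ // subrr normr0 mul0r.
  by rewrite /f -[X in X * _]ger0_norm // -normrM; congr (`|_|); field.
have m_ge0 : 0 <= m by apply: sumr_ge0 => z _; rewrite mulr_ge0 ?normr_ge0.
rewrite -(ger0_norm m_ge0) -sqrtr_sqr ler_sqrt ?chi2_ge0 //.
(* nonnegativity of the variance of [|P/Q - 1|] under [Q] *)
have : 0 <= \sum_z Q z * (f z - m) ^+ 2.
  by apply: sumr_ge0 => z _; rewrite mulr_ge0 ?sqr_ge0.
have -> : \sum_z Q z * (f z - m) ^+ 2
    = \sum_z (Q z * (P z / Q z - 1) ^+ 2 - 2 * m * (Q z * f z) + m ^+ 2 * Q z).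
  by apply: eq_bigr => z _; rewrite -(real_normK (num_real (P z / Q z - 1))) /f; ring.
rewrite big_split sumrB /= -!mulr_sumr Q_sum1 -/m.
rewrite -[X in X - _ + _]/(chi2 P Q); nra.
Qed.

Lemma test_errorE phi :
  test_error P Q phi = 2^-1 - 2^-1 * \sum_z (P z - Q z) * phi z.
Proof.
rewrite /test_error.
under eq_bigr do rewrite mulrBr mulr1.
rewrite sumrB P_sum1.
under [in RHS]eq_bigr do rewrite mulrBl.
rewrite sumrB; ring.
Qed.

Lemma test_error_ge phi : is_test phi ->
  2^-1 - 2^-1 * Num.sqrt (chi2 P Q) <= test_error P Q phi.
Proof.
move=> phi01; rewrite test_errorE lerB // ler_pM2l ?invr_gt0 //.
apply: le_trans sum_dist_le_sqrt_chi2; apply: ler_sum => z _.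
have /andP[phi0 phi1] := phi01 z.
apply: le_trans (ler_norm _) _; rewrite normrM (ger0_norm phi0).
by rewrite ler_piMr.
Qed.

Lemma min_error_bounds :
  2^-1 - 2^-1 * Num.sqrt (chi2 P Q) <= min_error P Q <= 2^-1.
Proof.
have mem0 : [set e : R | exists phi : T -> R,
    is_test phi /\ e = test_error P Q phi] (2^-1).
  (* Always deciding for [Q] errs with probability 1/2. *)
  exists (fun=> 0); split; first by move=> z; rewrite lexx ler01.
  by rewrite test_errorE big1 ?mulr0 ?subr0 // => z _; rewrite mulr0.
have lb : lbound [set e : R | exists phi : T -> R,
    is_test phi /\ e = test_error P Q phi]
    (2^-1 - 2^-1 * Num.sqrt (chi2 P Q)).
  by move=> _ [phi [phi01 ->]]; exact: test_error_ge.
apply/andP; split; first by apply: lb_le_inf => //; exists 2^-1.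
by apply: ge_inf => //; exists (2^-1 - 2^-1 * Num.sqrt (chi2 P Q)).
Qed.

End Chi2.

(** * Asymptotics in the sparse regime *)

Section Asymptotics.
Context {R : realType}.

Lemma expn2_le_powR_bin {eta : R} {n p k : nat} : (k <= p)%N ->
  n%:R <= (1 - eta) * log2 ('C(p, k)%:R : R) ->
  2 ^+ n <= 'C(p, k)%:R `^ (1 - eta) :> R.
Proof.
move=> kp nle.
have N0 : 0 < 'C(p, k)%:R :> R by rewrite ltr0n bin_gt0.
have l2 : 0 < ln 2 :> R by rewrite ln_gt0 ?ltr1n.
rewrite -powR_mulrn // /powR gt_eqF // gt_eqF // ler_expR.
by move: nle; rewrite /log2 mulrA ler_pdivlMr.
Qed.

(** After raising both sides to the power k, this is [expn2_le_powR_bin] followed by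
    [bin_exp_bound]. *)
Lemma powR2_rate_le {eta : R} {n p k : nat} : 0 < eta < 1 ->
  (0 < k)%N -> (k <= p)%N ->
  n%:R <= (1 - eta) * log2 ('C(p, k)%:R : R) ->
  2 `^ (n%:R / k%:R) <= (expR 1 * (p%:R / k%:R)) `^ (1 - eta) :> R.
Proof.
move=> /andP[eta0 eta1] k0 kp nle.
have p0 : (0 < p)%N := leq_trans k0 kp.
have kR : 0 < k%:R :> R by rewrite ltr0n.
have pR : 0 < p%:R :> R by rewrite ltr0n.
rewrite -(@ler_pXn2r _ k) ?nnegrE ?powR_ge0 //.
rewrite -powR_mulrn ?powR_ge0 // -powRrM divfK ?gt_eqF // powR_mulrn //.
apply: le_trans (expn2_le_powR_bin kp nle) _.
rewrite -[leRHS]powR_mulrn ?powR_ge0 // -powRrM [_ * k%:R]mulrC powRrM.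
rewrite powR_mulrn ?mulr_ge0 ?expR_ge0 ?divr_ge0 //.
rewrite ge0_ler_powR ?nnegrE ?subr_ge0 ?ler0n ?exprn_ge0 ?mulr_ge0 ?expR_ge0 ?divr_ge0 ?(ltW eta1) //.
rewrite exprMn -expRM_natl mulr1 -invf_div exprVn ler_pdivlMr ?exprn_gt0 ?divr_gt0 //.
exact: bin_exp_bound.
Qed.

Lemma overlap_sum_le_expR {eta : R} {n p k : nat} : 0 < eta < 1 ->
  (0 < k)%N -> (k <= p)%N ->
  n%:R <= (1 - eta) * log2 ('C(p, k)%:R : R) ->
  ('C(p, k)%:R)^-1 * (\sum_(0 <= l < k.+1)
     'C(k, l)%:R * 'C(p - k, l)%:R * 2 `^ (n%:R * (1 - l%:R / k%:R)))
  <= expR (expR 1 * (k%:R * (k%:R / p%:R) `^ eta)) :> R.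
Proof.
move=> eta01 k0 kp nle; have /andP[eta0 eta1] := eta01.
have p0 : (0 < p)%N := leq_trans k0 kp.
have kR : 0 < k%:R :> R by rewrite ltr0n.
have pR : 0 < p%:R :> R by rewrite ltr0n.
(* [W] is the cost of one unit of overlap: 2 ^ (n (1 - l / k)) is [W ^+ (k - l)]. *)
set W : R := 2 `^ (n%:R / k%:R).
have -> : \sum_(0 <= l < k.+1)
     'C(k, l)%:R * 'C(p - k, l)%:R * 2 `^ (n%:R * (1 - l%:R / k%:R))
   = \sum_(0 <= l < k.+1) 'C(k, l)%:R * 'C(p - k, l)%:R * W ^+ (k - l) :> R.
  apply: eq_big_nat => l; rewrite ltnS => /andP[_ lk]; congr (_ * _).
  rewrite -powR_mulrn ?powR_ge0 // -powRrM; congr (_ `^ _).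
  by rewrite natrB //; field; rewrite gt_eqF.
apply: le_trans (overlap_sum_le k0 kp (powR_ge0 _ _)) _.
have W_le := powR2_rate_le eta01 k0 kp nle.
(* Here (k / p) (e p / k) ^ (1 - eta) = e ^ (1 - eta) (k / p) ^ eta, and e ^ (1 - eta) <= e. *)
have yle : k%:R / p%:R * W <= expR 1 * (k%:R / p%:R) `^ eta.
  apply: (@le_trans _ _ (k%:R / p%:R * (expR 1 * (p%:R / k%:R)) `^ (1 - eta))).
    by rewrite ler_wpM2l // divr_ge0.
  rewrite powRM ?expR_ge0 ?divr_ge0 // mulrCA ler_pM ?powR_ge0 //.
    by rewrite -[leRHS]powRr1 ?expR_ge0 // ler_powR -?expR0 ?ler_expR ?ler01 // gerBl ltW.
  rewrite -{1}[k%:R / p%:R]powRr1 ?divr_ge0 // -[p%:R / _]invf_div.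
  rewrite -[(k%:R / p%:R)^-1]powR_inv1 ?divr_ge0 // -powRrM -powRD; last first.
    by apply/implyP => _; rewrite mulf_neq0 ?invr_eq0 ?gt_eqF.
  by rewrite (_ : 1 + _ = eta) //; ring.
apply: (@le_trans _ _ (expR (k%:R / p%:R * W) ^+ k)).
  rewrite lerXn2r ?nnegrE ?expR_ge0 ?expR_ge1Dx //.
rewrite -expRM_natl ler_expR [leRHS]mulrCA.
by rewrite ler_wpM2l.
Qed.

Lemma littleo_eventually_le {eta : R} {k : nat -> nat} :
  (fun p => (k p)%:R : R^o) =o_\oo (fun p => (p%:R : R) `^ (eta / (1 + eta)) : R^o) ->
  forall e : R, 0 < e ->
  \forall p \near \oo, (k p)%:R <= e * p%:R `^ (eta / (1 + eta)).
Proof.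
move=> /eqoP kp e e0; have := kp e e0; apply: filterS => p.
by rewrite /= normr_nat [X in _ * X]ger0_norm ?powR_ge0.
Qed.

(** The exponent eta / (1 + eta) is below 1. For k > p there is no set of size k, so the bounds only
    make sense eventually. *)
Lemma littleo_eventually_le_id {eta : R} {k : nat -> nat} : 0 < eta < 1 ->
  (fun p => (k p)%:R : R^o) =o_\oo (fun p => (p%:R : R) `^ (eta / (1 + eta)) : R^o) ->
  \forall p \near \oo, (k p <= p)%N.
Proof.
move=> eta01 kp; have /andP[eta0 eta1] := eta01.
near=> p.
have p1 : (1 <= p)%N by near: p; exists 1%N.
rewrite -(ler_nat R); apply: (@le_trans _ _ (1 * p%:R `^ (eta / (1 + eta)))).
  by near: p; exact: littleo_eventually_le.
rewrite mul1r -[leRHS]powRr1 // ler_powR ?ler1n //.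
rewrite ler_pdivrMr; lra.
Unshelve. all: by end_near. Qed.

(** The expression equals (k / p ^ (eta / (1 + eta))) ^ (1 + eta), which explains the sparsity
    threshold. *)
Lemma littleo_cvg0 {eta : R} {k : nat -> nat} : 0 < eta < 1 ->
  (fun p => (k p)%:R : R^o) =o_\oo (fun p => (p%:R : R) `^ (eta / (1 + eta)) : R^o) ->
  (k p)%:R * ((k p)%:R / p%:R) `^ eta @[p --> \oo] --> (0 : R).
Proof.
move=> eta01 kp; have /andP[eta0 eta1] := eta01.
apply/cvgrPdist_le => e e0.
(* Capping at 1 gives d ^ (1 + eta) <= d <= e. *)
pose d : R := Num.min e 1.
have d0 : 0 < d by rewrite lt_min e0 ltr01.
have de : d <= e by rewrite ge_min lexx.
have d1 : d <= 1 by rewrite ge_min lexx orbT.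
near=> p.
have p1 : (1 <= p)%N by near: p; exists 1%N.
have pR : 0 < p%:R :> R by rewrite ltr0n.
rewrite sub0r normrN ger0_norm ?mulr_ge0 ?powR_ge0 //.
have h : (k p)%:R <= d * p%:R `^ (eta / (1 + eta)).
  by near: p; exact: littleo_eventually_le.
have eD : 1 + eta != 0 by rewrite gt_eqF // addr_gt0.
have powD (x : R) : 0 <= x -> x * x `^ eta = x `^ (1 + eta).
  move=> x0; rewrite powRD ?powRr1 //; by rewrite (negbTE eD).
rewrite powRM ?invr_ge0 // mulrA powD // -powR_inv1 // -powRrM mulN1r powRN.
rewrite ler_pdivrMr ?powR_gt0 //.
apply: (@le_trans _ _ ((d * p%:R `^ (eta / (1 + eta))) `^ (1 + eta))).
  by rewrite ge0_ler_powR ?nnegrE ?mulr_ge0 ?powR_ge0 ?(ltW d0) //; lra.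
rewrite powRM ?powR_ge0 ?(ltW d0) // -powRrM divfK // ler_wpM2r ?powR_ge0 //.
apply: le_trans de; rewrite -powD ?(ltW d0) // ler_piMr ?(ltW d0) //.
have E1 : 1 `^ eta = 1 :> R by rewrite powR1.
rewrite -[leRHS]E1 ge0_ler_powR ?nnegrE ?(ltW eta0) ?(ltW d0) //.
Unshelve. all: by end_near. Qed.

End Asymptotics.

(** * The joint law of design and outcomes, and its divergence *)

Section JointLaw.
Context {R : realType} {n p k : nat} {nu : R}.
Local Notation q := (1 - nu / k%:R).
Local Notation P := (@joint_pmf R n p k nu).
Local Notation D := (@design_pmf R n p (nu / k%:R)).
Hypotheses (k_gt0 : (0 < k)%N) (k_le_p : (k <= p)%N).
Hypotheses (theta01 : 0 <= nu / k%:R <= 1) (half : q ^+ k = 2^-1).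

Let N_gt0 : 0 < 'C(p, k)%:R :> R.
Proof. by rewrite ltr0n bin_gt0. Qed.

Lemma sum_defective (F : {set 'I_p} -> R) :
  \sum_S defective_pmf R k S * F S
  = ('C(p, k)%:R)^-1 * \sum_(S : {set 'I_p} | #|S| == k) F S.
Proof.
rewrite mulr_sumr [RHS]big_mkcond /=; apply: eq_bigr => S _.
by rewrite /defective_pmf; case: ifP => _; rewrite ?mul0r.
Qed.

Lemma defective_sum1 : \sum_(S : {set 'I_p}) defective_pmf R k S = 1.
Proof.
have := sum_defective (fun=> 1); under eq_bigr do rewrite mulr1.
move=> ->; rewrite sumr_const -[#|_|]/#|[pred S : {set 'I_p} | #|S| == k]|.
rewrite -cardsE card_draws card_ord mulVf //; by rewrite gt_eqF.
Qed.

Lemma joint_pmfE X y : P (X, y)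
  = D X * \sum_S defective_pmf R k S * (y == outcome X S)%:R.
Proof.
by rewrite mulr_sumr; apply: eq_bigr => S _ /=; ring.
Qed.

Lemma fst_joint X : fst_marginal P X = D X.
Proof.
rewrite /fst_marginal; under eq_bigr do rewrite joint_pmfE.
rewrite -mulr_sumr exchange_big /= -[RHS]mulr1 -[X in _ = _ * X]defective_sum1; congr (_ * _).
apply: eq_bigr => S _; rewrite -mulr_sumr (bigD1 (outcome X S)) //= eqxx.
by rewrite big1 ?addr0 ?mulr1 // => y /negbTE ->.
Qed.

Lemma snd_joint y : snd_marginal P y = 2^-1 ^+ n.
Proof.
transitivity (\sum_S defective_pmf R k S * \sum_X D X * (y == outcome X S)%:R).
  rewrite /snd_marginal exchange_big /=; apply: eq_bigr => S _.
  by rewrite mulr_sumr; apply: eq_bigr => X _; rewrite mulrA.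
rewrite -[RHS]mul1r -[X in _ = X * _]defective_sum1 mulr_suml; apply: eq_bigr => S _.
rewrite /defective_pmf; case: eqP => [Sk|_]; last by rewrite !mul0r.
by rewrite design_outcome_half // Sk.
Qed.

Lemma joint_sum1 : \sum_z P z = 1.
Proof.
rewrite -(pair_bigA _ (fun X y => P (X, y))) /= -(@design_sum1 R (nu / k%:R) n p).
by apply: eq_bigr => X _; rewrite -fst_joint.
Qed.

Lemma prod_marginals_joint X y : prod_marginals P (X, y) = D X * 2^-1 ^+ n.
Proof. by rewrite /prod_marginals fst_joint snd_joint. Qed.

Lemma prod_marginals_joint_ge0 z : 0 <= prod_marginals P z.
Proof.
case: z => X y; rewrite prod_marginals_joint.
by rewrite mulr_ge0 ?exprn_ge0 ?invr_ge0 // design_pmf_ge0.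
Qed.

Lemma prod_marginals_joint_sum1 : \sum_z prod_marginals P z = 1.
Proof.
rewrite -(pair_bigA _ (fun X y => fst_marginal P X * snd_marginal P y)) /=.
transitivity ((\sum_z P z) * (\sum_z P z)); last by rewrite joint_sum1 mulr1.
rewrite -!(pair_bigA _ (fun X y => P (X, y))) /=.
rewrite [X in _ = _ * X]exchange_big /=.
by rewrite mulr_suml; apply: eq_bigr => X _; rewrite mulr_sumr.
Qed.

(** Every outcome has positive marginal mass, so the product vanishes only where the design mass
    does, and that mass is a factor of the joint law. *)
Lemma joint_abs_cont z : prod_marginals P z = 0 -> P z = 0.
Proof.
case: z => X y; rewrite prod_marginals_joint joint_pmfE => /eqP.
rewrite mulf_eq0 expf_eq0 invr_eq0 pnatr_eq0 andbF orbF => /eqP ->.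
by rewrite mul0r.
Qed.

(** Positivity identifies q as the k-th root of 1/2; q = 0 would contradict [half] because k > 0. *)
Lemma q_gt0 : 0 < q.
Proof.
have /andP[_ h] := theta01.
rewrite lt0r subr_ge0 h andbT; apply/eqP => q0.
by have := half; rewrite q0 expr0n gtn_eqF //= => /eqP; rewrite eq_sym invr_eq0 pnatr_eq0.
Qed.

Lemma q_powR : q = 2 `^ (- k%:R^-1).
Proof.
have k0 : k%:R != 0 :> R by rewrite pnatr_eq0 -lt0n.
apply/(@pexpIrn R k); rewrite ?nnegrE ?powR_ge0 ?(ltW q_gt0) //.
by rewrite half -powR_mulrn ?powR_ge0 // -powRrM mulNr mulVf // powR_inv1.
Qed.

(** [2 * q ^+ l] is the agreement probability of one row divided by the probability 1/2 of its
    outcome. *)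
Lemma collision_powR l : (2 * q ^+ l) ^+ n = 2 `^ (n%:R * (1 - l%:R / k%:R)).
Proof.
have n2 (x : R) : 2 `^ (n%:R * x) = 2 `^ x ^+ n.
  by rewrite mulrC powRrM powR_mulrn ?powR_ge0.
rewrite n2; congr (_ ^+ n); rewrite q_powR -powR_mulrn ?powR_ge0 // -powRrM.
rewrite -{1}[2]powRr1 // -powRD; last by rewrite pnatr_eq0 implybT.
by congr (_ `^ _); ring.
Qed.

(** A second-moment computation: the square of the joint law is a sum over two independent defective
    sets, dividing by the product law leaves a factor 2 ^ n, and summing over y keeps the event that
    their outcomes agree. *)
Lemma chi2_joint : chi2 P (prod_marginals P) =
  ('C(p, k)%:R)^-1 * (\sum_(0 <= l < k.+1)
     'C(k, l)%:R * 'C(p - k, l)%:R * 2 `^ (n%:R * (1 - l%:R / k%:R))) - 1.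
Proof.
rewrite chi2_sum_sqr; first last.
- exact: joint_abs_cont.
- exact: joint_sum1.
- exact: prod_marginals_joint_sum1.
congr (_ - 1).
transitivity (\sum_X \sum_y \sum_S \sum_S'
    2 ^+ n * (defective_pmf R k S * defective_pmf R k S') *
    (D X * (y == outcome X S)%:R * (y == outcome X S')%:R)).
  rewrite -(pair_bigA _ (fun X y => P (X, y) ^+ 2 / prod_marginals P (X, y))) /=.
  apply: eq_bigr => X _; apply: eq_bigr => y _.
  rewrite prod_marginals_joint joint_pmfE.
  set u := \sum_S _.
  transitivity (2 ^+ n * D X * (u * u)).
    (* Where the design has no mass the quotient is 0 / 0, that is 0. *)
    have [->|D0] := eqVneq (D X) 0; first by rewrite expr2; ring.
    by rewrite exprVn; field; rewrite D0 expf_neq0.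
  rewrite mulr_suml mulr_sumr; apply: eq_bigr => S _.
  by rewrite !mulr_sumr; apply: eq_bigr => S' _; ring.
transitivity (\sum_S \sum_S' 2 ^+ n * (defective_pmf R k S * defective_pmf R k S') *
    \sum_X D X * (outcome X S == outcome X S')%:R).
  under eq_bigr do rewrite exchange_big /=.
  rewrite exchange_big /=; apply: eq_bigr => S _.
  under eq_bigr do rewrite exchange_big /=.
  rewrite exchange_big /=; apply: eq_bigr => S' _.
  rewrite mulr_sumr; apply: eq_bigr => X _.
  rewrite -mulr_sumr (bigD1 (outcome X S)) //= eqxx mulr1 big1 ?addr0 //.
  by move=> y /negbTE ->; rewrite mulr0 mul0r.
transitivity (\sum_S defective_pmf R k S *
    (('C(p, k)%:R)^-1 * \sum_(S' : {set 'I_p} | #|S'| == k) (2 * q ^+ #|S' :\: S|) ^+ n)).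
  apply: eq_bigr => S _; rewrite -sum_defective mulr_sumr; apply: eq_bigr => S' _.
  rewrite design_outcomes_agree //.
  rewrite /defective_pmf; case: eqP => [Sk|_]; last by rewrite !(mul0r, mulr0).
  case: eqP => [S'k|_]; last by rewrite !(mul0r, mulr0).
  have -> : #|S :|: S'| = (k + #|S' :\: S|)%N.
    by rewrite cardsU cardsD finset.setIC Sk S'k addnBA // -S'k subset_leq_card // finset.subsetIl.
  (* A row agrees with probability 1 - 1/2 - 1/2 + 2 (1/2) q ^ l = q ^ l. *)
  rewrite Sk S'k exprD half.
  rewrite (_ : 1 - _ - _ + _ = q ^+ #|S' :\: S|); last by lra.
  by rewrite [in RHS]exprMn; ring.
(* The inner average is the same for every S of size k, so averaging over S leaves it unchanged. *)
rewrite -[RHS]mul1r -[X in _ = X * _]defective_sum1 [RHS]mulr_suml; apply: eq_bigr => S _.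
rewrite /defective_pmf; case: eqP => [Sk|_]; last by rewrite !mul0r.
congr (_ * (_ * _)); rewrite (sum_draws_setD (fun l => (2 * q ^+ l) ^+ n) Sk).
by apply: eq_bigr => l _; rewrite collision_powR.
Qed.

End JointLaw.

(** * Convergence of the divergence and of the error *)

Theorem theorem4 (R : realType) (eta : R) (k n : nat -> nat) (nu : nat -> R)
  (eta01 : 0 < eta < 1)
  (k_ge1 : forall p, (1 <= k p)%N)
  (nu_bernoulli : forall p, 0 <= nu p / (k p)%:R <= 1)
  (nu_half : forall p, (1 - nu p / (k p)%:R) ^+ (k p) = 2^-1)
  (n_le : forall p, (k p <= p)%N ->
     (n p)%:R <= (1 - eta) * log2 ('C(p, k p)%:R : R))
  (k_littleo : (fun p => (k p)%:R : R^o)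
     =o_\oo (fun p => (p%:R : R) `^ (eta / (1 + eta)) : R^o)) :
  let P p := @joint_pmf R (n p) p (k p) (nu p) in
  let Q p := prod_marginals (P p) in
  [/\ forall p, (k p <= p)%N ->
        chi2 (P p) (Q p) =
          ('C(p, k p)%:R)^-1 *
            (\sum_(0 <= l < (k p).+1)
               'C(k p, l)%:R * 'C(p - k p, l)%:R
                 * 2 `^ ((n p)%:R * (1 - l%:R / (k p)%:R))) - 1,
      chi2 (P p) (Q p) @[p --> \oo] --> (0 : R)
    & min_error (P p) (Q p) @[p --> \oo] --> (2^-1 : R)].
Proof.
move=> P Q.
have law p (kp : (k p <= p)%N) := chi2_joint (n := n p) (k_ge1 p) kp (nu_bernoulli p) (nu_half p).
have kp_near := littleo_eventually_le_id eta01 k_littleo.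
have chi2_to0 : chi2 (P p) (Q p) @[p --> \oo] --> (0 : R).
  (* The sandwich holds as soon as [k p <= p], hence eventually. *)
  apply: (@squeeze_cvgr _ _ _ _ (fun=> 0)
    (fun p => expR (expR 1 * ((k p)%:R * ((k p)%:R / p%:R) `^ eta)) - 1)).
  - apply: filterS kp_near => p kp; apply/andP; split.
      apply: chi2_ge0 => z.
      exact: (prod_marginals_joint_ge0 kp (nu_bernoulli p) (nu_half p)).
    rewrite /P /Q law // lerB //.
    exact: (overlap_sum_le_expR eta01 (k_ge1 p) kp (n_le p kp)).
  - exact: cvg_cst.
  - rewrite [X in _ --> X](_ : 0 = expR (expR 1 * 0) - 1); last first.
      by rewrite mulr0 expR0 subrr.
    apply: cvgB; last exact: cvg_cst.
    apply: (cvg_comp _ expR); last exact: continuous_expR.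
    by apply: cvgMr; exact: littleo_cvg0.
split=> //.
have bounds p (kp : (k p <= p)%N) := min_error_bounds
  (prod_marginals_joint_ge0 (n := n p) kp (nu_bernoulli p) (nu_half p))
  (prod_marginals_joint_sum1 (n := n p) kp)
  (joint_sum1 kp)
  (joint_abs_cont kp (nu_half p)).
(* Continuity of the square root at 0 closes the gap between the two bounds of
   [min_error_bounds]. *)
apply: (@squeeze_cvgr _ _ _ _
  (fun p => 2^-1 - 2^-1 * Num.sqrt (chi2 (P p) (Q p))) (fun=> 2^-1)).
- by apply: filterS kp_near => p kp; exact: bounds.
- rewrite -[X in _ --> X]subr0 -(mulr0 2^-1) -sqrtr0.
  apply: cvgB; first exact: cvg_cst.
  apply: cvgMr; apply: (cvg_comp _ Num.sqrt) chi2_to0 _.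
  exact: sqrt_continuous.
- exact: cvg_cst.
Qed.
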